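(* Let $n\ge 3$ and let $M:=\mathbf{P}(n,\mathbb{N})\cong\mathbb{N}^{n-1}$. If $S$ is a thick unipotent numerical monoid in $M$, then $$(n-1)\,k^{n-1}\ \le\ \mathtt{e}(S)\,\mathtt{n}_M(S),$$ where $k=\mathtt{r}_M(S)$ is the generating number of $S$ relative to $M$.
   Context: $\mathbb{N}=\{0,1,2,\dots\}$. $\mathbf{P}(n,\mathbb{N})$ is the monoid of $n\times n$ matrices with entries in $\mathbb{N}$, all diagonal entries $1$, and whose only possibly nonzero off-diagonal entries lie in the first row; reading off the entries in positions $(1,2),\dots,(1,n)$ identifies it with the additive monoid $\mathbb{N}^{n-1}$, and we work in $M=\mathbb{N}^{n-1}$. A unipotent numerical monoid in $M$ is a submonoid $S$ of $M$ with $M\setminus S$ finite. For a positive integer $k$ let $P(k):=\{0\}\cup\{(x_1,\dots,x_{n-1})\in\mathbb{N}^{n-1}:\max_i x_i\ge k\}$. The generating number $\mathtt{r}_M(S)$ is the smallest positive integer $k$ with $P(k)\subseteq S$. The genus is $\mathtt{g}_M(S):=|M\setminus S|$. The sporadicity $\mathtt{n}_M(S):=|\{0\}\cup (S\setminus P(\mathtt{r}_M(S)))|$ is the number of elements of $S$ all of whose coordinates are $<\mathtt{r}_M(S)$. The embedding dimension $\mathtt{e}(S)$ is the minimum cardinality of a generating set of the monoid $S$. For $1\le j\le n-1$, the coordinate submonoid $S_j$ is the set of elements of $S$ whose coordinates other than the $j$-th are all $0$, viewed as a submonoid of $\mathbb{N}$ (it has finite complement); its genus is $\mathtt{g}_j:=|\mathbb{N}\setminus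 S_j|$. $S$ is called thick if $\sum_{j=1}^{n-1}\mathtt{g}_j=\mathtt{g}_M(S)$. *)

(* Defs.v *)
From mathcomp Require Import all_boot all_order all_algebra finmap.
From mathcomp Require Import boolp classical_sets cardinality.

Set Implicit Arguments.
Unset Strict Implicit.
Unset Printing Implicit Defensive.

Import GRing.Theory.
Local Open Scope classical_set_scope.
Local Open Scope ring_scope.

(* 0 when P is empty *)
Definition least (P : set nat) : nat :=
  xget 0%N [set k | P k /\ forall j, P j -> (k <= j)%N].

(* 0 when A is infinite *)
Definition fincard (T : choiceType) (A : set T) : nat := #|` fset_set A|%fset.

Definition submonoid (V : nmodType) (S : set V) : Prop :=
  S 0 /\ forall x y, S x -> S y -> S (x + y).

Definition embedding_dimension (V : nmodType) (S : set V) : nat :=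
  least [set c | exists A : set V,
    [/\ finite_set A, fincard A = c & smallest (@submonoid V) A = S]].

Definition genus (T : choiceType) (S : set T) : nat := fincard (~` S).

(* The monoid N^m is the additive monoid of row vectors 'rV[nat]_m; the
   matrix monoid P(n, N) is identified with it for m = n.-1. *)
Definition unipotent_numerical_monoid m (S : set 'rV[nat]_m) : Prop :=
  submonoid S /\ finite_set (~` S).

Definition Pset {m} (k : nat) : set 'rV[nat]_m :=
  [set 0] `|` [set x : 'rV[nat]_m | (k <= \max_(i < m) x 0%R i)%N].

Definition generating_number m (S : set 'rV[nat]_m) : nat :=
  least [set k | (0 < k)%N /\ Pset k `<=` S].

Definition sporadicity m (S : set 'rV[nat]_m) : nat :=
  fincard ([set 0] `|` (S `\` Pset (generating_number S))).

Definition coordinate_submonoid m (S : set 'rV[nat]_m) (j : 'I_m) : set nat :=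
  [set x 0 j | x in [set x : 'rV[nat]_m | S x /\ forall i, i != j -> x 0 i = 0]].

Definition thick m (S : set 'rV[nat]_m) : Prop :=
  (\sum_(j < m) genus (coordinate_submonoid S j))%N = genus S.

(* Main.v *)
(** Put m = n - 1, k = r(S) and let T be the set of directions j whose basis
    vector e_j is a gap, t = |T|.  Thickness says that every gap lies on a
    coordinate axis, so the embedding dimension is at least the number of the
    following irreducible elements: on each axis the multiplicity m_j e_j; on
    each axis in T also the least c_j e_j in S with m_j not dividing c_j; and
    e_i + e_j for each pair {i, j} meeting T.  Hence 2 (e - m) >= t (m + 1).
    On the other hand n(S) + g(S) = k^m with g(S) <= t (k - 1), and
    (m + 2)(k - 1) <= k^m gives n(S) >= 2 (k - 1), so m g(S) <= (e - m) n(S). *)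
Require Import Defs.
From mathcomp Require Import all_boot all_order all_algebra finmap.
From mathcomp Require Import boolp classical_sets cardinality.
From mathcomp Require Import zify.

Set Implicit Arguments.
Unset Strict Implicit.
Unset Printing Implicit Defensive.

Import GRing.Theory.

(** * Cardinalities of sets by means of injections from finite types *)

Section Counting.
Local Open Scope classical_set_scope.

Lemma least_spec (P : set nat) : (exists k, P k) ->
  P (least P) /\ forall j, P j -> least P <= j.
Proof.
move=> [k0 Pk0].
have exP : exists k, `[< P k >] by exists k0; apply/asboolP.
case: (ex_minnP exP) => k /asboolP Pk kmin.
apply: (@xgetPex _ 0 [set k | P k /\ forall j, P j -> k <= j]).
by exists k; split=> // j Pj; apply/kmin/asboolP.
Qed.

Context {T : finType} {U : choiceType}.
Variables (f : T -> U) (P : {set T}) (A : set U).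
Hypothesis f_inj : {in P &, injective f}.

Let fP := [fset f x | x in P]%fset.

Let card_fP : #|` fP|%fset = #|P|.
Proof. by rewrite card_in_imfset //= -cardE. Qed.

Lemma fincard_image :
  (forall u, A u <-> exists2 x, x \in P & f x = u) -> fincard A = #|P|.
Proof.
move=> AP; rewrite /fincard -card_fP; congr (#|` _|)%fset.
rewrite -[RHS]set_fsetK; congr fset_set.
apply/seteqP; split=> u /=.
  by move=> /AP[x xP <-]; apply/imfsetP; exists x.
by move=> /imfsetP[x xP ->]; apply/AP; exists x.
Qed.

Hypothesis finA : finite_set A.
Hypothesis fPA : forall x, x \in P -> A (f x).

Let fP_sub : (fP `<=` fset_set A)%fset.
Proof.
apply/fsubsetP => u /imfsetP[x xP ->].
by rewrite in_fset_set // inE; apply: fPA.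
Qed.

Lemma leq_card_fincard : #|P| <= fincard A.
Proof. by rewrite -card_fP; apply: fsubset_leq_card. Qed.

(** Pigeonhole: the image of [P] is a subset of [A] of full cardinality. This turns the numerical
    equality of thickness into information on each gap. *)
Lemma card_fincard_onto u : #|P| = fincard A -> A u -> exists2 x, x \in P & f x = u.
Proof.
rewrite -card_fP => eq_card Au.
have /fsubset_cardP/(_ fP_sub u) := eq_card.
by rewrite in_fset_set // mem_set // => /imfsetP[x xP ->]; exists x.
Qed.

End Counting.

(** * Irreducible elements and generating sets *)

Section Atoms.
Context {V : nmodType}.
Implicit Types (S A : set V).
Local Open Scope classical_set_scope.

Definition atom S (x : V) := [/\ S x, x <> 0%R &
  forall y z, S y -> S z -> (y + z)%R = x -> y = 0%R \/ z = 0%R].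

(** Removing an irreducible element from [S] leaves a submonoid, so a set [A] missing [x] would
    generate at most [S] without [x]. *)
Lemma atom_mem_generators S A x : smallest (@submonoid V) A = S -> atom S x -> A x.
Proof.
move=> genA [Sx x0 xatom]; apply: contrapT => nAx.
have submonS : submonoid S.
  rewrite -genA; split=> [B [[]]//|y z Sy Sz B [[B0 BD] AB]].
  by apply: (BD); [apply: (Sy B)|apply: (Sz B)].
suff: (S `\ x) x by case=> _ /(_ erefl).
move: Sx; rewrite -{1}genA; apply; split; last first.
  move=> y Ay; split=> [|yx]; last by apply: nAx; rewrite -yx.
  by rewrite -genA => B [_]; apply.
case: submonS => S0 SD; split; first by split=> // /esym.
move=> y z [Sy yx] [Sz zx]; split; first exact: SD.
move=> yzx; case: (xatom y z Sy Sz yzx) => E; rewrite E in yzx.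
  by apply: zx; rewrite -yzx add0r.
by apply: yx; rewrite -yzx addr0.
Qed.

(** Every generating set contains all atoms. Finite generation excludes the default value 0 of
    [least]. *)
Lemma leq_atoms_embedding_dimension (T : finType) (f : T -> V) (P : {set T}) S :
    (exists A, finite_set A /\ smallest (@submonoid V) A = S) ->
    {in P &, injective f} -> (forall t, t \in P -> atom S (f t)) ->
  #|P| <= embedding_dimension S.
Proof.
move=> [A0 [finA0 genA0]] finj fatom.
rewrite /embedding_dimension.
have [|[A [finA <- genA]] _] := @least_spec [set c | exists A : set V,
    [/\ finite_set A, fincard A = c & smallest (@submonoid V) A = S]].
  by exists (fincard A0), A0.
apply: (leq_card_fincard finj finA) => t tP.
exact: atom_mem_generators genA (fatom t tP).
Qed.

End Atoms.

(** * Axis vectors, indicators and boxes in N^m *)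

Section RowVectors.
Variable m : nat.
Implicit Types (x y z : 'rV[nat]_m) (j : 'I_m) (X : {set 'I_m}).

Lemma row_addE x y j : (x + y)%R 0%R j = x 0%R j + y 0%R j.
Proof. by rewrite mxE. Qed.

Lemma row_zeroE j : (0 : 'rV[nat]_m)%R 0%R j = 0.
Proof. by rewrite mxE. Qed.

Lemma row_eqP x y : (forall j, x 0%R j = y 0%R j) <-> x = y.
Proof. by split=> [xy|->//]; apply/rowP. Qed.

Definition axis j (a : nat) : 'rV[nat]_m := (\row_i (if i == j then a else 0))%R.

Lemma axisE j a i : axis j a 0%R i = if i == j then a else 0.
Proof. by rewrite mxE. Qed.

Lemma axisx j a : axis j a 0%R j = a.
Proof. by rewrite axisE eqxx. Qed.

Lemma axis0 j : axis j 0 = 0%R.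
Proof. by apply/row_eqP => i; rewrite axisE row_zeroE if_same. Qed.

Lemma axisD j a b : axis j (a + b) = (axis j a + axis j b)%R.
Proof. by apply/row_eqP => i; rewrite row_addE !axisE; case: ifP. Qed.

Lemma axis_neq0 j a : 0 < a -> axis j a <> 0%R.
Proof. by move=> + /row_eqP/(_ j); rewrite axisx row_zeroE => /[swap] ->. Qed.

Lemma axis_addP j a y z : (y + z)%R = axis j a ->
  [/\ y = axis j (y 0%R j), z = axis j (z 0%R j) & y 0%R j + z 0%R j = a].
Proof.
move=> yz; split; last by rewrite -row_addE yz axisx.
all: apply/row_eqP => i; rewrite axisE; case: eqP => [->//|/eqP/negPf ij].
all: by move/row_eqP/(_ i): yz; rewrite row_addE axisE ij; lia.
Qed.

Definition indicator X : 'rV[nat]_m := (\row_i nat_of_bool (i \in X))%R.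

Lemma indicatorE X i : indicator X 0%R i = (i \in X).
Proof. by rewrite mxE. Qed.

Definition row_support x : {set 'I_m} := [set i | x 0%R i != 0].

Lemma row_support_axis j a : 0 < a -> row_support (axis j a) = [set j].
Proof.
by move=> a0; apply/setP => i; rewrite !inE axisE; case: (i == j) => //; lia.
Qed.

Lemma row_support_indicator X : row_support (indicator X) = X.
Proof. by apply/setP => i; rewrite inE indicatorE; case: (i \in X). Qed.

Lemma PsetP k x : 0 < k ->
  Pset k x <-> x = 0%R \/ exists j, k <= x 0%R j.
Proof.
move=> k0; split=> [[->|]|[->|[j kxj]]]; [by left| |by left|right].
  rewrite /= => kx; right; apply/not_existsP => xk; move: kx; apply/negP.
  rewrite -ltnNge -(prednK k0) ltnS; apply/bigmax_leqP => j _.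
  by move: (xk j); lia.
by apply: leq_trans kxj _; apply: leq_bigmax.
Qed.

(** Presents the cube of vectors with coordinates below [k] as a finite type, of cardinality k^m. *)
Definition of_box k (x : 'rV['I_k]_m) : 'rV[nat]_m := map_mx (@nat_of_ord k) x.

Lemma of_box_inj k : injective (@of_box k).
Proof.
move=> x y /row_eqP xy; apply/rowP => j; apply: val_inj.
by have := xy j; rewrite !mxE.
Qed.

Lemma of_box_lt k (u : 'rV['I_k]_m) j : of_box u 0%R j < k.
Proof. by rewrite mxE. Qed.

Lemma of_boxP k x : (forall j, x 0%R j < k) -> exists u, @of_box k u = x.
Proof.
move=> xk; exists (\row_j Ordinal (xk j))%R.
by apply/row_eqP => j; rewrite !mxE.
Qed.

End RowVectors.

(** * Generating number, finite generation, genus and sporadicity *)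

Section NumericalMonoids.
Local Open Scope classical_set_scope.
Context {m : nat} {S : set 'rV[nat]_m}.
Implicit Types (x y z : 'rV[nat]_m) (j : 'I_m).
Hypothesis hS : unipotent_numerical_monoid S.

Lemma generating_number_spec :
  0 < generating_number S /\ Pset (generating_number S) `<=` S.
Proof.
rewrite /generating_number.
have [|//] := @least_spec [set k | 0 < k /\ Pset k `<=` S].
case: hS => [[S0 _] finC].
(* One more than the largest coordinate of any gap. *)
exists (\max_(x <- fset_set (~` S)) \max_(i < m) x 0%R i).+1; split=> // x.
move=> /(PsetP _ (ltn0Sn _))[->//|[j xj]]; apply: contrapT => nSx.
have xC : x \in fset_set (~` S) by rewrite in_fset_set // inE.
move: xj; apply/negP; rewrite -leqNgt.
apply: (@leq_trans (\max_(i < m) x 0%R i)).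
  exact: leq_bigmax.
exact: (leq_bigmax_seq (F := fun x : 'rV_m => \max_(i < m) x 0%R i)).
Qed.

Lemma generating_number_gt0 : 0 < generating_number S.
Proof. by case: generating_number_spec. Qed.

Lemma mem_generating_number x j : generating_number S <= x 0%R j -> S x.
Proof.
case: generating_number_spec => k0 PkS kx.
by apply/PkS/PsetP => //; right; exists j.
Qed.

Lemma gap_lt x j : ~ S x -> x 0%R j < generating_number S.
Proof. by rewrite ltnNge => nSx; apply/negP => /mem_generating_number. Qed.

(* An element with a coordinate at least 2k splits off k times a basis vector,
   and both parts lie in P(k); so the elements with coordinates below 2k
   generate. *)
Lemma numerical_monoid_fg :
  exists A : set 'rV[nat]_m, finite_set A /\ smallest (@submonoid _) A = S.
Proof.
set k := generating_number S; have k0 : 0 < k := generating_number_gt0.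
case: (hS) => [Smon _].
pose A := [set x | S x /\ forall j, x 0%R j < k + k].
exists A; split.
  apply: (@sub_finite_set _ _ [set` [fset of_box u | u in [set: 'rV['I_(k + k)]_m]%SET]%fset]).
    by move=> x [_ /of_boxP[y <-]] /=; apply/imfsetP; exists y => //=; rewrite inE.
  exact: finite_fset.
apply/seteqP; split; first by apply: smallest_sub => // x [].
(* Induction on the coordinate sum, which drops by [k] at each splitting. *)
suff gen n x : \sum_j x 0%R j < n -> S x -> smallest (@submonoid _) A x.
  by move=> x; apply: gen (ltnSn _).
elim: n x => // n IH x xn Sx.
case: (pselect (forall j, x 0%R j < k + k)) => [xk|/existsNP[j /negP]].
  by apply: sub_gen_smallest.
rewrite -leqNgt => xj.
pose y : 'rV[nat]_m := (\row_i (if i == j then (x 0%R i - k)%N else x 0%R i))%R.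
have xE : x = (y + axis j k)%R.
  apply/row_eqP => i; rewrite row_addE axisE mxE; case: eqP => [->|_]; lia.
have Sy : S y by apply: (@mem_generating_number y j); rewrite mxE eqxx -/k; lia.
have Sk : S (axis j k) by apply: (@mem_generating_number _ j); rewrite axisx.
have AD B y' z : submonoid B /\ A `<=` B -> B y' -> B z -> B (y' + z)%R.
  by move=> [[_ BD] _]; apply: BD.
rewrite xE => B [Bmon AB]; apply: (AD B) => //; last first.
  apply: AB; split=> // i; rewrite axisE; case: ifP; lia.
apply: (IH y) => //; suff : \sum_i x 0%R i = \sum_i y 0%R i + k by lia.
rewrite {1}xE (eq_bigr _ (fun i _ => row_addE _ _ i)) big_split /=; congr (_ + _).
rewrite (bigD1 j) //= axisx big1 ?addn0 // => i /negPf ij.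
by rewrite axisE ij.
Qed.

(** All gaps lie in the cube with coordinates below [k], and the elements of [S] in this cube are
    those that [sporadicity] counts. *)
Lemma sporadicity_genus : sporadicity S + genus S = generating_number S ^ m.
Proof.
set k := generating_number S; have k0 : 0 < k := generating_number_gt0.
pose B := [set u : 'rV['I_k]_m | `[< S (of_box u) >]]%SET.
have -> : sporadicity S = #|B|.
  apply: (@fincard_image _ _ (@of_box m k)) => [? ? _ _ /of_box_inj//|x].
  rewrite -/k; split=> [[->|[Sx]]|[y]].
  - have [|y yE] := @of_boxP m k 0%R; first by move=> j; rewrite row_zeroE.
    by exists y => //; rewrite inE yE; apply/asboolP; case: hS => [[]].
  - move=> nPx; have [j|y yE] := @of_boxP m k x.
      rewrite ltnNge; apply/negP => kx; apply: nPx.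
      by apply/PsetP => //; right; exists j.
    by exists y => //; rewrite inE yE; apply/asboolP.
  rewrite inE => /asboolP Sy <-.
  (* Zero belongs to [Pset k], so only the added singleton accounts for it. *)
  case: (eqVneq (of_box y) 0%R) => [->|/eqP y0]; [by left|right].
  split=> // /(PsetP _ k0)[//|[j]]; apply/negP.
  by rewrite -ltnNge of_box_lt.
have -> : genus S = #|~: B|.
  apply: (@fincard_image _ _ (@of_box m k)) => [? ? _ _ /of_box_inj//|x].
  split=> [nSx|[y] + <-]; last by rewrite !inE => /asboolP.
  have [j|y yE] := @of_boxP m k x; first exact: gap_lt.
  by exists y => //; rewrite !inE yE; apply/asboolP.
by rewrite cardsC card_mx card_ord mul1n.
Qed.

Lemma coordinate_submonoidE j a : coordinate_submonoid S j a <-> S (axis j a).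
Proof.
split=> [[x [Sx x0] <-]|Sa].
  suff -> : axis j (x 0%R j) = x by [].
  apply/row_eqP => i; rewrite axisE; case: eqP => [->//|/eqP ij].
  by rewrite x0.
exists (axis j a); last exact: axisx.
by split=> // i /negPf ij; rewrite axisE ij.
Qed.

Lemma genus_coordinate_submonoid j :
  genus (coordinate_submonoid S j) =
  #|[set a : 'I_(generating_number S) | ~~ `[< S (axis j a) >]]%SET|.
Proof.
apply: (@fincard_image _ _ (@nat_of_ord _)) => [? ? _ _ /val_inj//|a].
split=> [nSa|[b] + <-].
  have {}nSa : ~ S (axis j a) by move=> /coordinate_submonoidE.
  have := gap_lt j nSa; rewrite axisx => ak.
  by exists (Ordinal ak) => //; rewrite inE; apply/asboolP.
by rewrite inE => /asboolP nSb /coordinate_submonoidE.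
Qed.

Definition gap_directions : {set 'I_m} := [set j | ~~ `[< S (axis j 1) >]]%SET.

Lemma mem_axis j a : j \notin gap_directions -> S (axis j a).
Proof.
case: hS => [[S0 SD] _]; rewrite inE negbK => /asboolP Sj.
by elim: a => [|a IH]; [rewrite axis0|rewrite -addn1 axisD; apply: SD].
Qed.

(** An axis outside [gap_directions] lies in [S] and contributes nothing; on any other axis the gaps
    are among 1, ..., k - 1. *)
Lemma leq_sum_genus :
  \sum_(j < m) genus (coordinate_submonoid S j) <=
  #|gap_directions| * (generating_number S).-1.
Proof.
rewrite -sum_nat_const big_mkcond [leqRHS]big_mkcond /=; apply: leq_sum => j _.
rewrite genus_coordinate_submonoid; case: ifPn => jT; last first.
  rewrite leqn0 cards_eq0; apply/eqP/setP => a; rewrite !inE.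
  by apply/negbF/asboolP/mem_axis.
rewrite -[X in _ <= X.-1]card_ord.
rewrite -(cardsC1 (Ordinal generating_number_gt0)); apply: subset_leq_card.
apply/fintype.subsetP => a; rewrite !inE; apply: contraNneq => ->.
by apply/asboolP; rewrite /= axis0; case: hS => [[]].
Qed.

(** Distinct axes meet only in 0, which is not a gap, so the gaps on the axes number exactly the sum
    of the coordinate genera. Thickness makes this the number of all gaps. *)
Lemma thick_gap_axis x : thick S -> ~ S x -> exists j a, x = axis j a.
Proof.
move=> thickS nSx.
case: (hS) => [[S0 _] finC].
pose P := [set p : 'I_m * 'I_(generating_number S) |
  ~~ `[< S (axis p.1 p.2) >]]%SET.
have Pgap p : p \in P -> ~ S (axis p.1 p.2) by rewrite inE => /asboolP.
have cardP : #|P| = genus S.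
  rewrite -thickS -sum1_card.
  rewrite (eq_bigl (fun p => true && (p.2 \in
      [set a : 'I_(generating_number S) | ~~ `[< S (axis p.1 a) >]]%SET)));
    last by move=> p; rewrite !inE.
  rewrite -(pair_big_dep predT (fun j a => a \in
     [set a : 'I_(generating_number S) | ~~ `[< S (axis j a) >]]%SET)
     (fun _ _ => 1)) /=.
  by apply: eq_bigr => j _; rewrite sum1_card genus_coordinate_submonoid.
have P_inj : {in P &, injective (fun p : 'I_m * 'I__ => axis p.1 p.2)}.
  move=> [j a] [i b] /Pgap /= nSa /Pgap /= nSb E.
  have a0 : 0 < a by rewrite lt0n; apply/eqP => a0; apply: nSa; rewrite a0 axis0.
  have b0 : 0 < b by rewrite lt0n; apply/eqP => b0; apply: nSb; rewrite b0 axis0.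
  have ji : j = i by apply/set1_inj; rewrite -(row_support_axis j a0) E row_support_axis.
  rewrite -ji; congr pair; apply/val_inj => /=.
  by move/row_eqP/(_ j): E; rewrite ji !axisx.
have [p _ <-] := card_fincard_onto P_inj finC Pgap cardP nSx.
by exists p.1, p.2.
Qed.

End NumericalMonoids.

(** * Three families of irreducible elements of a thick monoid *)

Section ThickAtoms.
Local Open Scope classical_set_scope.
Context {m : nat} {S : set 'rV[nat]_m}.
Implicit Types (x y z : 'rV[nat]_m) (j : 'I_m).
Hypothesis hS : unipotent_numerical_monoid S.

Let T := @gap_directions m S.

Definition multiplicity j := least [set a | 0 < a /\ S (axis j a)].

Lemma multiplicity_spec j :
  [/\ 0 < multiplicity j, S (axis j (multiplicity j)) &
      forall a, 0 < a -> S (axis j a) -> multiplicity j <= a].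
Proof.
have [|[m0 Sm] mmin] := @least_spec [set a | 0 < a /\ S (axis j a)].
  exists (generating_number S); split; first exact: generating_number_gt0.
  by apply: (mem_generating_number hS (j := j)); rewrite axisx.
by split=> // a a0 Sa; apply: mmin.
Qed.

(** The second smallest minimal generator of the coordinate submonoid, if [multiplicity j] exceeds
    1; otherwise the default 0. *)
Definition second_atom j :=
  least [set a | S (axis j a) /\ ~~ (multiplicity j %| a)].

Lemma second_atom_spec j : j \in T ->
  [/\ S (axis j (second_atom j)), ~~ (multiplicity j %| second_atom j) &
      forall a, S (axis j a) -> ~~ (multiplicity j %| a) -> second_atom j <= a].
Proof.
rewrite inE => /asboolP nS1.
have [m0 Sm _] := multiplicity_spec j.
have m1 : 1 < multiplicity j.
  by rewrite ltn_neqAle m0 andbT; apply: contra_notN nS1 => /eqP ->.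
have [|[Sc mc] cmin] :=
    @least_spec [set a | S (axis j a) /\ ~~ (multiplicity j %| a)].
  (* This exceeds the generating number and is 1 modulo [multiplicity j], which is greater than
     1. *)
  exists (generating_number S * multiplicity j + 1); split.
    by apply: (mem_generating_number hS (j := j)); rewrite axisx; nia.
  by rewrite dvdn_addr ?dvdn_mull // dvdn1; lia.
by split=> // a Sa ma; apply: cmin.
Qed.

(** Summands of an axis vector lie on the same axis, since coordinates cannot cancel; irreducibility
    is thus a one-dimensional question. *)
Lemma axis_atom j a : 0 < a -> S (axis j a) ->
    (forall b c, b + c = a -> S (axis j b) -> S (axis j c) -> b = 0 \/ c = 0) ->
  atom S (axis j a).
Proof.
move=> a0 Sa airr; split=> // [|y z Sy Sz /axis_addP[yE zE yza]].
  exact: axis_neq0.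
rewrite yE in Sy; rewrite zE in Sz.
have [E|E] := airr _ _ yza Sy Sz; first by left; rewrite yE E axis0.
by right; rewrite zE E axis0.
Qed.

Lemma multiplicity_atom j : atom S (axis j (multiplicity j)).
Proof.
have [m0 Sm mmin] := multiplicity_spec j.
apply: axis_atom => // b c bc Sb Sc.
have [->|b0] := posnP b; first by left.
have [->|c0] := posnP c; first by right.
have := mmin b b0 Sb; lia.
Qed.

(** Two positive summands would be smaller, hence multiples of [multiplicity j] by minimality, and
    so would be their sum. *)
Lemma second_atom_atom j : j \in T -> atom S (axis j (second_atom j)).
Proof.
move=> jT; have [Sc mc cmin] := second_atom_spec jT.
apply: axis_atom => // [|b c bc Sb Sc'].
  by rewrite lt0n; apply: contraNneq mc => ->; rewrite dvdn0.
have [->|b0] := posnP b; first by left.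
have [->|c0] := posnP c; first by right.
case: (boolP (multiplicity j %| b)) => [mb|/(cmin _ Sb)]; last lia.
case: (boolP (multiplicity j %| c)) => [mc'|/(cmin _ Sc')]; last lia.
by case/negP: mc; rewrite -bc dvdn_addr.
Qed.

(** A vector with two nonzero coordinates is off the axes, so it is not a gap. Its only nontrivial
    splitting is into two basis vectors, one of which is a gap. *)
Lemma indicator_atom (X : {set 'I_m}) : thick S -> #|X| = 2 ->
  ~~ (X \subset ~: T)%SET -> atom S (indicator X).
Proof.
move=> thickS X2 XT.
have [j jX jT] : exists2 j, j \in X & j \in T.
  by case/subsetPn: XT => j jX; rewrite inE negbK; exists j.
have X0 : indicator X <> 0%R.
  by move=> /row_eqP/(_ j); rewrite indicatorE jX row_zeroE.
split=> // [|y z Sy Sz yz].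
  apply: contrapT => /(thick_gap_axis hS thickS)[i [a XE]].
  have [a0|a0] := posnP a; first by rewrite XE a0 axis0 in X0.
  by move: X2; rewrite -(row_support_indicator X) XE row_support_axis // cards1.
have yzE i : y 0%R i + z 0%R i = (i \in X) by rewrite -row_addE yz indicatorE.
(* The summand that vanishes in direction j is supported on the other element
   of X, so the other summand is the basis vector in direction j, a gap. *)
have key (u v : 'rV[nat]_m) : S u -> (forall i, u 0%R i + v 0%R i = (i \in X)) ->
    v 0%R j = 0 -> v = 0%R.
  move=> Su uv vj; apply: contrapT => v0.
  have [i vi] : exists i, v 0%R i != 0.
    apply/not_existsP => v0'; apply: v0; apply/row_eqP => i.
    by rewrite row_zeroE; apply/eqP/negPn/negP/v0'.
  have ij : i != j by apply: contraNneq vi => ->; rewrite vj.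
  have iX : i \in X by move: (uv i) vi; case: (i \in X) => //=; lia.
  have XE : X = [set i; j]%SET.
    apply/esym/eqP; rewrite eqEcard X2 cards2 ij andbT.
    by apply/fintype.subsetP => l; rewrite !inE => /orP[/eqP ->|/eqP ->].
  move: jT; rewrite inE => /asboolP; apply.
  suff <- : u = axis j 1 by [].
  apply/row_eqP => l; rewrite axisE.
  have := uv l; rewrite XE !inE.
  have [->|lj] := eqVneq l j; first by rewrite orbT vj; lia.
  have [->|li] := eqVneq l i; last by rewrite /=; lia.
  by rewrite /=; move: vi; lia.
have := yzE j; rewrite jX => yzj.
have [zj|zj] := posnP (z 0%R j).
  by right; apply: key Sy yzE zj.
left; apply: key Sz _ _ => [i|]; first by rewrite addnC.
by move: yzj zj => /=; lia.
Qed.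

(** The disjoint sum as index type lets the three families be counted separately. *)
Definition thick_atom (t : {set 'I_m} + 'I_m + 'I_m) : 'rV[nat]_m :=
  match t with
  | inl (inl X) => indicator X
  | inl (inr j) => axis j (multiplicity j)
  | inr j => axis j (second_atom j)
  end.

Definition thick_atom_index : {set {set 'I_m} + 'I_m + 'I_m} :=
  [set t : {set 'I_m} + 'I_m + 'I_m | match t with
           | inl (inl X) => (#|X| == 2) && ~~ (X \subset ~: T)%SET
           | inl (inr j) => true
           | inr j => j \in T
           end]%SET.

Lemma thick_atomP t : thick S -> t \in thick_atom_index -> atom S (thick_atom t).
Proof.
move=> thickS; rewrite inE; case: t => [[X|j]|j] /=.
- by move=> /andP[/eqP X2 XT]; apply: indicator_atom.
- by move=> _; apply: multiplicity_atom.
- exact: second_atom_atom.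
Qed.

Lemma thick_atom_inj : {in thick_atom_index &, injective thick_atom}.
Proof.
have m0 j : 0 < multiplicity j by have [] := multiplicity_spec j.
have c0 j : j \in T -> 0 < second_atom j.
  move=> jT; have [_ + _] := second_atom_spec jT.
  by rewrite lt0n; apply: contraNneq => ->; rewrite dvdn0.
have cm j : j \in T -> multiplicity j != second_atom j.
  by move=> jT; have [_ + _] := second_atom_spec jT; apply: contraNneq => ->.
(* The size of the support separates the pairs from the axis atoms. *)
have card_supp t : t \in thick_atom_index ->
    #|row_support (thick_atom t)| = if t is inl (inl _) then 2 else 1.
  rewrite inE; case: t => [[X|j]|j] /=.
  - by move=> /andP[/eqP X2 _]; rewrite row_support_indicator.
  - by rewrite row_support_axis // cards1.
  - by move=> /c0 c0j; rewrite row_support_axis // cards1.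
have axisI i j a b : 0 < a -> 0 < b -> axis i a = axis j b -> i = j /\ a = b.
  move=> a0 b0 E; have ij : i = j.
    by apply/set1_inj; rewrite -(row_support_axis i a0) E row_support_axis.
  by split=> //; move/row_eqP/(_ i): E; rewrite ij !axisx.
move=> t u tP uP E.
have := card_supp t tP; rewrite E (card_supp u uP).
move: tP uP E; rewrite !inE.
case: t u => [[X|i]|i] [[Y|j]|j] //=.
- move=> _ _ E _; congr (inl (inl _)).
  by rewrite -(row_support_indicator X) E row_support_indicator.
- by move=> _ _ /axisI[] // ->.
- move=> _ jT /axisI[]; rewrite ?c0 // => -> mc.
  by move: (cm j jT); rewrite mc eqxx.
- move=> iT _ /axisI[]; rewrite ?c0 // => <- mc.
  by move: (cm i iT); rewrite mc eqxx.
- by move=> iT jT /axisI[]; rewrite ?c0 // => ->.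
Qed.

(** The pairs left out of the index are the 2-subsets of the complement of [T]; adding their number
    avoids truncated subtraction. *)
Lemma card_thick_atom_index :
  #|thick_atom_index| + 'C(m - #|T|, 2) = 'C(m, 2) + m + #|T|.
Proof.
pose D := [set X : {set 'I_m} | #|X| == 2]%SET.
pose E := [set X : {set 'I_m} | X \subset ~: T]%SET.
have -> : #|thick_atom_index| = #|(D :\: E)%SET| + m + #|T|.
  rewrite -sum1_card !big_sumType /= -[X in _ = _ + X + _](card_ord m) -!sum1_card.
  by congr (_ + _ + _); apply: eq_bigl => X; rewrite !inE // andbC.
have <- : #|(D :&: E)%SET| = 'C(m - #|T|, 2).
  have <- : #|(~: T)%SET| = m - #|T| by rewrite cardsCs finset.setCK card_ord.
  by rewrite -cards_draws; apply: eq_card => X; rewrite !inE andbC.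
have <- : #|D| = 'C(m, 2) by rewrite card_draws card_ord.
rewrite -(cardsID E D); lia.
Qed.

End ThickAtoms.

(** * Numerical inequalities and conclusion *)

Lemma expn_ge k m : 1 < m -> (m + 2) * k.-1 <= k ^ m.
Proof.
case: k => [|k] /=; first by rewrite muln0.
case: m => [|[|m]] // _.
(* With [k] now the predecessor, the base case 4k <= (k + 1)^2 is (k - 1)^2 >= 0; for positive [k]
   the factor k + 1 >= 2 covers the next case. *)
elim: m => [|m IH]; first by rewrite -mulnn; nia.
rewrite expnS; have [->|k0] := posnP k; first by rewrite muln0.
apply: leq_trans (leq_mul (leqnn k.+1) IH); nia.
Qed.

Lemma thick_arith m t k e g N :
  1 < m -> t <= m -> g <= t * k.-1 -> N + g = k ^ m ->
  'C(m, 2) + m + t <= e + 'C(m - t, 2) -> m * k ^ m <= e * N.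
Proof.
move=> m1 tm gt Ng ce.
have te : t * (m + 1) + 2 * m <= 2 * e.
  (* Writing m = t + p and expanding the binomials, the inequality holds with slack t p. *)
  have [p mE] : exists p, m = t + p by exists (m - t); lia.
  have bin2E n : 'C(n, 2) * 2 + n = n * n.
    by elim: n => // n IH; rewrite binS bin1; lia.
  have := bin2E m; have := bin2E (m - t); rewrite mE addKn => E1 E2.
  by move: ce; rewrite mE addKn; nia.
have kN : 2 * k.-1 <= N.
  have := expn_ge k m1; have : t * k.-1 <= m * k.-1 by rewrite leq_mul2r tm orbT.
  lia.
(* Relaxing m to m + 1 produces the factor t (m + 1) of [te]. *)
have gN : 2 * m * g <= t * (m + 1) * N.
  apply: (@leq_trans (2 * (m + 1) * (t * k.-1))); first by apply: leq_mul; lia.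
  by rewrite [leqLHS](_ : _ = t * (m + 1) * (2 * k.-1)) ?leq_mul2l ?kN ?orbT; lia.
rewrite -Ng mulnDr; have := leq_mul te (leqnn N); lia.
Qed.

Theorem theorem6p5 (n : nat) (hn : (3 <= n)%N) (S : set 'rV[nat]_(n.-1))
    (hS : unipotent_numerical_monoid S) (hthick : thick S) :
  (n.-1 * generating_number S ^ n.-1 <= embedding_dimension S * sporadicity S)%N.
Proof.
apply: (@thick_arith _ #|@gap_directions _ S| _ _ (genus S)).
- by lia.
- by rewrite -[X in _ <= X](card_ord n.-1) max_card.
- by rewrite -hthick leq_sum_genus.
- exact: sporadicity_genus.
rewrite -card_thick_atom_index leq_add2r.
apply: leq_atoms_embedding_dimension (thick_atom_inj hS) _.
  exact: numerical_monoid_fg.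
by move=> t; apply: thick_atomP.
Qed.
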